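(* Consider the distributed VIP with operators $f_1,\dots,f_n:\mathbb{R}^{d'}\to\mathbb{R}^{d'}$, and suppose: it attains a unique solution $z^*\in\mathbb{R}^{d'}$; each $f_i$ is $\mu$-quasi-strongly monotone around $z^*$ ($\mu>0$), i.e. $\langle f_i(u)-f_i(z^* ),u-z^*\rangle\ge\mu\|u-z^*\|^2$ for all $u\in\mathbb{R}^{d'}$; and each $g_i(u)$ is an unbiased estimator of $f_i(u)$ such that, for some $L_g>0$, $\mathbb{E}\|g_i(u)-g_i(z^* )\|^2\le L_g\langle f_i(u)-f_i(z^* ),u-z^*\rangle$ for all $u\in\mathbb{R}^{d'}$. Let $\sigma_*^2:=\sum_{i=1}^n\mathbb{E}\|g_i(z^* )-f_i(z^* )\|^2<+\infty$. Let $\epsilon>0$ and run ProxSkip-VIP-FL with $g_{i,t}=g_i(x_{i,t})$ and $$\gamma=\min\left\{\frac{1}{2L_g},\frac{1}{2\mu},\frac{\mu\epsilon}{8\sigma_*^2}\right\},\qquad p=\sqrt{\gamma\mu},$$ and let $V_t:=\sum_{i=1}^n\|x_{i,t}-z^*\|^2+\left(\frac{\gamma}{p}\right)^2\sum_{i=1}^n\|h_{i,t}-f_i(z^* )\|^2$. Then the algorithm achieves $\mathbb{E}[V_T]\le\epsilon$ with iteration complexity $$\mathcal{O}\left(\max\left\{\frac{L_g}{\mu},\frac{\sigma_*^2}{\mu^2\epsilon}\right\}\ln\frac1\epsilon\right)$$ and communication complexity $$\mathcal{O}\left(\sqrt{\max\left\{\frac{L_g}{\mu},\frac{\sigma_*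^2}{\mu^2\epsilon}\right\}}\,\ln\frac1\epsilon\right).$$
   Context: **Distributed VIP.** Find $z^*\in\mathbb{R}^{d'}$ with $\langle F(z^* ),z-z^*\rangle\ge0$ for all $z\in\mathbb{R}^{d'}$, where $F(z)=\frac1n\sum_{i=1}^nf_i(z)$ (equivalently $F(z^* )=0$). Operator $f_i$ is held by client $i$. **Stochastic operators.** $g_i(u)=g_i(u;\xi_i)$ depends on a random sample; in $\|g_i(u)-g_i(z^* )\|$ both terms use the same sample. Fresh samples, independent of the past, are used at every iteration. **Algorithm ProxSkip-VIP-FL.** Input: (non-random) $x_{i,0},h_{i,0}\in\mathbb{R}^{d'}$ for $i=1,\dots,n$, $\gamma>0$, $p\in(0,1]$. For $t=0,1,2,\dots$: the server draws $\theta_t\in\{0,1\}$ with $\Pr(\theta_t=1)=p$, independently of the past and of the $g_{i,t}$; every client $i$ sets $\hat x_{i,t+1}=x_{i,t}-\gamma(g_{i,t}-h_{i,t})$. If $\theta_t=1$ (a communication round), each client sends $x_{i,t+1}'=\hat x_{i,t+1}-\frac{\gamma}{p}h_{i,t}$ and all clients receive $x_{i,t+1}=\frac1n\sum_{k=1}^nx_{k,t+1}'$; if $\theta_t=0$, $x_{i,t+1}=\hat x_{i,t+1}$. Then $h_{i,t+1}=h_{i,t}+\frac{p}{\gamma}(x_{i,t+1}-\hat x_{i,t+1})$. **Complexity conventions.** Iteration complexity $\mathcal{O}(N\ln\frac1\epsilon)$ means: $\mathbb{E}[V_T]\le\epsilon$ for some $T\le cN\ln\frac{V_0}{\epsilon}$,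 with $c$ a universal numerical constant, for $0<\epsilon\le V_0/2$ (the dependence on $V_0$ inside the logarithm is suppressed). Communication complexity is the expected number $pT$ of communication rounds for this $T$. If $\sigma_*=0$, the bound $\mu\epsilon/(8\sigma_*^2)$ is $+\infty$. *)

(* Defs.v *)
From HB Require Import structures.
From mathcomp Require Import all_boot all_order all_algebra.
From mathcomp Require Import all_classical all_reals all_analysis.

Set Implicit Arguments.
Unset Strict Implicit.
Unset Printing Implicit Defensive.

Import Order.TTheory GRing.Theory Num.Theory.
Local Open Scope classical_set_scope.
Local Open Scope ring_scope.

(* Euclidean inner product; the library norm `|u| on 'rV[R]_d is the sup norm,
   so the Euclidean norm enters only through [sqnorm]. *)
Definition dotv (R : realType) (d : nat) (u v : 'rV[R]_d) : R :=
  \sum_(k < d) u ord0 k * v ord0 k.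

Definition sqnorm (R : realType) (d : nat) (u : 'rV[R]_d) : R := dotv u u.

Definition mean (R : realType) (n d : nat) (v : 'I_n -> 'rV[R]_d) : 'rV[R]_d :=
  n%:R^-1 *: \sum_(i < n) v i.

Definition vip_solution (R : realType) (d : nat) (F : 'rV[R]_d -> 'rV[R]_d)
    (z : 'rV[R]_d) : Prop :=
  forall w, 0 <= dotv (F z) (w - z).

Definition quasi_strongly_monotone (R : realType) (d : nat) (mu : R)
    (F : 'rV[R]_d -> 'rV[R]_d) (zs : 'rV[R]_d) : Prop :=
  forall u, mu * sqnorm (u - zs) <= dotv (F u - F zs) (u - zs).

Section stochastic_operator.
Context (R : realType) (d : nat) (dS : measure_display) (S : measurableType dS).
Implicit Types (Q : probability S R) (g : 'rV[R]_d -> S -> 'rV[R]_d).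

(* Joint Borel measurability of (u, s) |-> g u s, with R^d presented as
   d.-tuple R, which carries the product sigma-algebra. *)
Definition jointly_measurable g : Prop :=
  forall k : 'I_d, measurable_fun [set: d.-tuple R * S]
    (fun q => g (\row_j tnth q.1 j) q.2 ord0 k).

Definition unbiased Q g (F : 'rV[R]_d -> 'rV[R]_d) : Prop :=
  forall (u : 'rV[R]_d) (k : 'I_d),
    Q.-integrable setT (fun s => (g u s ord0 k)%:E) /\
    ('E_Q[fun s => g u s ord0 k] = (F u ord0 k)%:E)%E.

Definition expected_cocoercive Q (L : R) g (F : 'rV[R]_d -> 'rV[R]_d)
    (zs : 'rV[R]_d) : Prop :=
  forall u, ('E_Q[fun s => sqnorm (g u s - g zs s)]
             <= (L * dotv (F u - F zs) (u - zs))%:E)%E.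

End stochastic_operator.

Definition noise_at (R : realType) (n d : nat) (dS : 'I_n -> measure_display)
    (S : forall i, measurableType (dS i)) (Q : forall i, probability (S i) R)
    (g : forall i, 'rV[R]_d -> S i -> 'rV[R]_d)
    (f : 'I_n -> 'rV[R]_d -> 'rV[R]_d) (zs : 'rV[R]_d) : \bar R :=
  (\sum_(i < n) 'E_(Q i)[fun s => sqnorm (g i zs s - f i zs)])%E.

(* The term mu * eps / (8 * sigma2) is +oo, hence absent, when sigma2 = 0. *)
Definition stepsize (R : realType) (L mu sigma2 eps : R) : R :=
  let m := Num.min (1 / (2 * L)) (1 / (2 * mu)) in
  if sigma2 == 0 then m else Num.min m (mu * eps / (8 * sigma2)).

Section proxskip_vip_fl.
Context (R : realType) (n d : nat).

(* The client iterates (x_i)_i together with the control vectors (h_i)_i. *)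
Definition fl_state : Type :=
  (('I_n -> 'rV[R]_d) * ('I_n -> 'rV[R]_d))%type.

Definition fl_step (gamma p : R) (theta : bool) (gt : 'I_n -> 'rV[R]_d)
    (st : fl_state) : fl_state :=
  let: (x, h) := st in
  let xhat i := x i - gamma *: (gt i - h i) in
  let x' i := xhat i - (gamma / p) *: h i in
  let xnew i := if theta then mean x' else xhat i in
  (xnew, fun i => h i + (p / gamma) *: (xnew i - xhat i)).

Definition lyapunov (gamma p : R) (f : 'I_n -> 'rV[R]_d -> 'rV[R]_d)
    (zs : 'rV[R]_d) (st : fl_state) : R :=
  \sum_(i < n) sqnorm (st.1 i - zs)
  + (gamma / p) ^+ 2 * \sum_(i < n) sqnorm (st.2 i - f i zs).

Context (dS : 'I_n -> measure_display) (S : forall i, measurableType (dS i)).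
Context (dO : measure_display) (Omega : measurableType dO).
Variables (g : forall i, 'rV[R]_d -> S i -> 'rV[R]_d).
Variables (xi : forall i, nat -> {mfun Omega >-> S i}).
Variables (theta : nat -> {mfun Omega >-> bool}).

Fixpoint fl_run (gamma p : R) (st0 : fl_state) (t : nat) (w : Omega)
    : fl_state :=
  if t is t'.+1 then
    let st := fl_run gamma p st0 t' w in
    fl_step gamma p (theta t' w) (fun i => g (st.1 i) (xi i t' w)) st
  else st0.

(* The estimates g_{i,t} = g_i(x_{i,t}; xi_{i,t}). *)
Definition fl_estimate (gamma p : R) (st0 : fl_state) (t : nat) (i : 'I_n)
    (w : Omega) : 'rV[R]_d :=
  g ((fl_run gamma p st0 t w).1 i) (xi i t w).

Definition comm_rounds (T : nat) (w : Omega) : R :=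
  \sum_(t < T) (theta t w : nat)%:R.

(* The following are generating families: the sigma-algebras they generate are
   taken in [fresh_samples] and [independent_coins]. *)
Definition sample_events (t : nat) : set_system Omega :=
  \bigcup_(i in [set: 'I_n]) preimage_set_system setT (xi i t) measurable.

Definition coin_events (t : nat) : set_system Omega :=
  preimage_set_system setT (theta t) measurable.

Definition past_events (t : nat) : set_system Omega :=
  \bigcup_(s in [set s | (s < t)%N]) (sample_events s `|` coin_events s).

Definition estimate_events (gamma p : R) (st0 : fl_state) (t : nat)
    : set_system Omega :=
  \bigcup_(i in [set: 'I_n]) \bigcup_(k in [set: 'I_d])
    preimage_set_system setT
      (fun w => fl_estimate gamma p st0 t i w ord0 k) measurable.

Variable P : probability Omega R.

Definition independent_systems (A B : set_system Omega) : Prop :=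
  forall a b, A a -> B b -> (P (a `&` b) = P a * P b)%E.

(* xi_{i,t} has law Q_i, and (xi_{1,t}, ..., xi_{n,t}) is independent of the
   past; the clients' samples within one iteration may be dependent. *)
Definition fresh_samples (Q : forall i, probability (S i) R) : Prop :=
  (forall i t B, measurable B -> distribution P (xi i t) B = Q i B) /\
  (forall t, independent_systems <<s past_events t >> <<s sample_events t >>).

(* theta_t is Bernoulli(p), independent of the past and the g_{i,t} jointly. *)
Definition independent_coins (gamma p : R) (st0 : fl_state) : Prop :=
  (forall t, P [set w | theta t w] = p%:E) /\
  (forall t, independent_systems
     <<s past_events t `|` estimate_events gamma p st0 t >>
     <<s coin_events t >>).

End proxskip_vip_fl.

(* Main.v *)
Require Import Defs.
From HB Require Import structures.
From mathcomp Require Import all_boot all_order all_algebra.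
From mathcomp Require Import all_classical all_reals all_analysis.
From mathcomp Require Import measurable_realfun ring lra.

Set Implicit Arguments.
Unset Strict Implicit.
Unset Printing Implicit Defensive.

Import Order.TTheory GRing.Theory Num.Theory.
Local Open Scope classical_set_scope.
Local Open Scope ring_scope.

(** The proof is a Lyapunov argument: the expected value of
    V = sum_i |x_i - z|^2 + (gamma / p)^2 sum_i |h_i - f_i z|^2
    contracts by the factor 1 - gamma mu at each iteration, up to an additive
    2 gamma^2 sigma^2.

    One iteration is analysed in two stages, in the reverse of the order in which
    its randomness is drawn. Averaging V over the coin alone gives an exact
    identity ([lyapunov_coin_average]): the new primal and dual errors recombine
    into the plain gradient step x_i - z - gamma (g_i - f_i z), while the dual
    error shrinks by the factor 1 - p^2. The choice p^2 = gamma mu makes this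
    shrinkage equal to the contraction of the gradient step. Averaging the
    gradient step over a fresh sample, with the point x_i fixed, gives the usual
    stochastic gradient bound ([expected_gradient_step]).

    Both averages are conditional expectations given a sigma-algebra, of which
    only one consequence is needed: a variable Y independent of a
    sub-sigma-algebra G may be integrated out of phi(w, Y w) with the
    G-measurable argument frozen ([integral_freezing]). This follows from
    Tonelli's theorem, as the joint law of (id, Y) on (Omega, G) * T is a
    product. All integrands are nonnegative, so that the recursion can be written
    with possibly infinite expectations and finiteness comes out at the end.

    Iterating, E V_T <= (1 - gamma mu)^T V_0 + 2 gamma sigma^2 / mu. The step size
    bounds the second term by eps / 4, and T of order ln(V_0 / eps) / (gamma mu)
    bounds the first by eps / 2. Finally 1 / (gamma mu) <= 8 N; this uses
    mu <= L_g, a consequence of Jensen's inequality that requires d > 0, which is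
    the case because V_0 > 0. *)

(** * Euclidean geometry *)

Section euclidean.
Context (R : realType) (d : nat).
Implicit Types (u v w : 'rV[R]_d) (c : R).

Lemma dotvC u v : dotv u v = dotv v u.
Proof. by apply: eq_bigr => k _; rewrite mulrC. Qed.

Lemma dotvDr u v w : dotv u (v + w) = dotv u v + dotv u w.
Proof. by rewrite -big_split; apply: eq_bigr => k _; rewrite mxE mulrDr. Qed.

Lemma dotvZr c u v : dotv u (c *: v) = c * dotv u v.
Proof. by rewrite mulr_sumr; apply: eq_bigr => k _; rewrite mxE mulrCA. Qed.

Lemma dotvNr u v : dotv u (- v) = - dotv u v.
Proof. by rewrite -scaleN1r dotvZr mulN1r. Qed.

Lemma dotv0r u : dotv u 0 = 0.
Proof. by rewrite -(scale0r (0 : 'rV[R]_d)) dotvZr mul0r. Qed.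

Lemma dotv_sumr (I : Type) (s : seq I) u (v : I -> 'rV[R]_d) :
  dotv u (\sum_(i <- s) v i) = \sum_(i <- s) dotv u (v i).
Proof. exact: (big_morph (dotv u) (dotvDr u) (dotv0r u)). Qed.

Lemma sqnorm_ge0 u : 0 <= sqnorm u.
Proof. by apply: sumr_ge0 => k _; rewrite -expr2 sqr_ge0. Qed.

Lemma sum_sqnorm_ge0 (I : Type) (s : seq I) (v : I -> 'rV[R]_d) :
  0 <= \sum_(i <- s) sqnorm (v i).
Proof. by apply: sumr_ge0 => i _; exact: sqnorm_ge0. Qed.

Lemma sqnorm_eq0 u : sqnorm u = 0 -> u = 0.
Proof.
move=> /eqP; rewrite psumr_eq0; last by move=> k _; rewrite -expr2 sqr_ge0.
move=> /allP u0; apply/rowP => k; rewrite mxE.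
by have := u0 k (mem_index_enum _); rewrite mulf_eq0 orbb => /eqP.
Qed.

Lemma sqnormZ c u : sqnorm (c *: u) = c ^+ 2 * sqnorm u.
Proof. by rewrite /sqnorm dotvZr dotvC dotvZr mulrA -expr2. Qed.

Lemma sqnormD u v : sqnorm (u + v) = sqnorm u + 2 * dotv u v + sqnorm v.
Proof.
rewrite /sqnorm dotvDr ![dotv (u + v) _]dotvC !dotvDr [dotv v u]dotvC.
ring.
Qed.

Lemma sqnormB u v : sqnorm (u - v) = sqnorm u - 2 * dotv u v + sqnorm v.
Proof.
by rewrite sqnormD dotvNr mulrN -[- v]scaleN1r sqnormZ sqrrN expr1n mul1r.
Qed.

Lemma sqnormD_le u v : sqnorm (u + v) <= 2 * sqnorm u + 2 * sqnorm v.
Proof. have := sqnorm_ge0 (u - v); rewrite sqnormB sqnormD; lra. Qed.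

End euclidean.

(** * Averaging one iteration over the coin *)

Section averaging.
Context (R : realType) (n d : nat).
Hypothesis n_gt0 : (0 < n)%N.
Implicit Types (v w : 'I_n -> 'rV[R]_d).

Let n_neq0 : n%:R != 0 :> R. Proof. by rewrite pnatr_eq0 -lt0n. Qed.

Lemma sum_mean v : \sum_(i < n) v i = n%:R *: mean v.
Proof. by rewrite /mean scalerA mulfV// scale1r. Qed.

Lemma mean_cst (u : 'rV[R]_d) : mean (fun _ : 'I_n => u) = u.
Proof.
by rewrite /mean sumr_const card_ord -[u *+ n]scaler_nat scalerA mulVf// scale1r.
Qed.

Lemma meanD v w : mean (fun i => v i + w i) = mean v + mean w.
Proof. by rewrite /mean big_split scalerDr. Qed.

Lemma meanZ c v : mean (fun i => c *: v i) = c *: mean v.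
Proof. by rewrite /mean -scaler_sumr !scalerA [c * _]mulrC. Qed.

(** The bias-variance decomposition of an empirical second moment. *)
Lemma sum_sqnorm_mean v :
  \sum_(i < n) sqnorm (mean v) + \sum_(i < n) sqnorm (mean v - v i)
  = \sum_(i < n) sqnorm (v i).
Proof.
rewrite -big_split /=.
transitivity (\sum_(i < n) (2 * sqnorm (mean v) - 2 * dotv (mean v) (v i)
                            + sqnorm (v i))).
  by apply: eq_bigr => i _; rewrite sqnormB; ring.
rewrite big_split big_split /= sumr_const card_ord sumrN -mulr_sumr.
rewrite -(dotv_sumr _ (mean v)) sum_mean dotvZr -/(sqnorm _); ring.
Qed.

(** Testing the variational inequality at [w = zs - F zs] gives
    [- sqnorm (F zs) >= 0]. *)
Lemma vip_solution_mean0 (f : 'I_n -> 'rV[R]_d -> 'rV[R]_d) (zs : 'rV[R]_d) :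
  vip_solution (fun z => mean (fun i => f i z)) zs ->
  mean (fun i => f i zs) = 0.
Proof.
set m := mean _ => zsP; apply: sqnorm_eq0; apply/le_anti.
rewrite sqnorm_ge0 andbT; have := zsP (zs - m).
by rewrite addrAC subrr add0r dotvNr oppr_ge0.
Qed.

Variables (gamma p : R) (f : 'I_n -> 'rV[R]_d -> 'rV[R]_d) (zs : 'rV[R]_d).
Hypotheses (gamma_neq0 : gamma != 0) (p_neq0 : p != 0).
Hypothesis mean_f0 : mean (fun i => f i zs) = 0.
Variables (gt : 'I_n -> 'rV[R]_d) (x h : 'I_n -> 'rV[R]_d).

Let xhat i := x i - gamma *: (gt i - h i).
Let a i := xhat i - zs - (gamma / p) *: (h i - f i zs).

(** After a communication round all clients sit at the mean of the corrected
    points, so with [a i] the corrected error of client [i] the primal part of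
    the Lyapunov function is the squared bias of [a] and its dual part the
    variance; they add up to the second moment of [a]. *)
Lemma lyapunov_comm :
  lyapunov gamma p f zs (fl_step gamma p true gt (x, h))
  = \sum_(i < n) sqnorm (a i).
Proof.
rewrite /lyapunov /fl_step /= -/(xhat _).
rewrite -(sum_sqnorm_mean a).
set x' := fun i => _ - (gamma / p) *: h i.
(* The shift by [(gamma / p) *: f i zs] disappears in the mean. *)
have mE : mean x' - zs = mean a.
  have -> : a = fun i => x' i + (- zs + (gamma / p) *: f i zs).
    by apply/funext => i; apply/rowP => k; rewrite /a /x' !mxE; ring.
  by rewrite !meanD meanZ mean_f0 scaler0 addr0 mean_cst.
rewrite mE; congr (_ + _); rewrite mulr_sumr; apply: eq_bigr => i _.
rewrite -sqnormZ; congr sqnorm; rewrite -mE /a; apply/rowP => k; rewrite !mxE.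
by field; rewrite p_neq0 n_neq0.
Qed.

(** With [u] the primal error of [xhat i] and [e] the dual error, the cross term
    of [p * sqnorm (u - (gamma / p) *: e)] is [- 2 * gamma * dotv u e], which
    does not depend on [p] and is that of [sqnorm (u - gamma *: e)]. Completing
    this square turns the control variate [h i] into [f i zs] and costs
    [gamma ^+ 2 * sqnorm e], that is, [p ^+ 2] times the dual term. *)
Lemma lyapunov_coin_average :
  p * lyapunov gamma p f zs (fl_step gamma p true gt (x, h))
  + (1 - p) * lyapunov gamma p f zs (fl_step gamma p false gt (x, h))
  = \sum_(i < n) sqnorm (x i - zs - gamma *: (gt i - f i zs))
    + (1 - p ^+ 2) * ((gamma / p) ^+ 2 * \sum_(i < n) sqnorm (h i - f i zs)).
Proof.
rewrite lyapunov_comm /lyapunov /fl_step /= !mulr_sumr -!big_split /=.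
rewrite !mulr_sumr -!big_split /=; apply: eq_bigr => i _.
rewrite subrr scaler0 addr0 -/(xhat i) /a; set e := h i - f i zs.
have -> : x i - zs - gamma *: (gt i - f i zs) = xhat i - zs - gamma *: e.
  by apply/rowP => k; rewrite !mxE; ring.
rewrite -/e; move: (xhat i - zs) e => u e'.
by rewrite !sqnormB !dotvZr !sqnormZ; field.
Qed.

End averaging.

(** * Integrating out an independent variable *)

Section integral_independent.
Local Open Scope ereal_scope.
Context (R : realType) (dO d1 d2 : measure_display).
Context (Omega : measurableType dO) (T1 : measurableType d1)
  (T2 : measurableType d2).
Variables (P : probability Omega R) (X : {mfun Omega >-> T1})
  (Y : {mfun Omega >-> T2}) (phi : T1 * T2 -> \bar R).
Hypothesis indep : forall A B, measurable A -> measurable B ->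
  P (X @^-1` A `&` Y @^-1` B) = P (X @^-1` A) * P (Y @^-1` B).
Hypothesis phi_measurable : measurable_fun setT phi.
Hypothesis phi_ge0 : forall z, 0 <= phi z.

Let J (w : Omega) : T1 * T2 := (X w, Y w).

Let mJ : measurable_fun [set: Omega] J.
Proof. by apply: measurable_fun_pair; exact: measurable_funP. Qed.

(** Independence says that the law of [J] agrees with the product of the two
    laws on rectangles, hence everywhere; the rest is Tonelli. *)
Lemma integral_independent :
  \int[P]_w phi (X w, Y w) = \int[P]_w \int[distribution P Y]_y phi (X w, y).
Proof.
have -> : \int[P]_w phi (X w, Y w) = \int[pushforward P J]_z phi z.
  by rewrite ge0_integral_pushforward.
have PJ A : measurable A ->
    (distribution P X \x distribution P Y) A = pushforward P J A.
  exact: (@product_measure_unique _ _ _ _ _ _ _ (pushforward P J)).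
transitivity (\int[distribution P X \x distribution P Y]_z phi z).
  by apply: eq_measure_integral => A mA _; exact/esym/PJ.
rewrite fubini_tonelli1// ge0_integral_distribution//.
  exact: measurable_fun_fubini_tonelli_F.
by move=> w; exact: integral_ge0.
Qed.

End integral_independent.

(** [Omega] carrying the smaller sigma-algebra generated by [G]: a function on it
    is measurable exactly when it is determined by the information in [G], so
    that conditioning on [G] amounts to taking the identity map into it as one
    of the two independent variables. *)
Definition coarsening (dO : measure_display) (Omega : measurableType dO)
    (G : set_system Omega) : measurableType (G.-sigma)%mdisp :=
  g_sigma_algebraType G.

Section coarsening.
Context (dO : measure_display) (Omega : measurableType dO) (G : set_system Omega).

Hypothesis G_measurable : G `<=` measurable.

Lemma g_sigma_algebra_measurable : <<s G >> `<=` measurable.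
Proof. exact: smallest_sub (sigma_algebra_measurable Omega) G_measurable. Qed.

Lemma measurable_fun_coarsening :
  measurable_fun [set: Omega] (idfun : Omega -> coarsening G).
Proof. by move=> _ B mB; rewrite setTI; exact: g_sigma_algebra_measurable. Qed.

Context (R : realType) (dT : measure_display) (T : measurableType dT).
Variables (P : probability Omega R) (Y : {mfun Omega >-> T})
  (phi : coarsening G * T -> \bar R).
Hypothesis indep : independent_systems P <<s G >>
  (preimage_set_system setT Y measurable).

(** Since [Y] is independent of the sigma-algebra generated by [G], the inner
    integral is the conditional expectation of [phi (w, Y w)] given [G]. *)
Lemma integral_freezing :
  measurable_fun setT phi -> (forall z, (0 <= phi z)%E) ->
  (\int[P]_w phi (w, Y w) =
   \int[P]_w \int[distribution P Y]_y phi (w, y))%E.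
Proof.
move=> mphi phi0.
apply: (@integral_independent _ _ _ _ _ _ _ _
  (mfun_Sub (mem_set measurable_fun_coarsening))) => //.
move=> A B mA mB; apply: indep => //.
by exists B => //; rewrite setTI.
Qed.

Lemma integral_freezing_le (psi : Omega -> \bar R) :
  measurable_fun setT phi -> (forall z, (0 <= phi z)%E) ->
  measurable_fun setT psi ->
  (forall w, (\int[distribution P Y]_y phi (w, y) <= psi w)%E) ->
  (\int[P]_w phi (w, Y w) <= \int[P]_w psi w)%E.
Proof.
move=> mphi phi0 mpsi le_psi; rewrite integral_freezing//.
apply: ge0_le_integral => //; first by move=> w _; exact: integral_ge0.
have mF := measurable_fun_fubini_tonelli_F (m2 := distribution P Y) phi mphi phi0.
exact: (measurableT_comp mF measurable_fun_coarsening).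
Qed.

End coarsening.

(** * Measurability of the states *)

Section measurable_rv.
Context (R : realType) (n d : nat) (dM : measure_display) (M : measurableType dM).
Implicit Types (v w : M -> 'rV[R]_d) (st : M -> fl_state R n d).

(** Coordinatewise, to match [jointly_measurable]. *)
Definition measurable_rv v : Prop :=
  forall k, measurable_fun setT (fun m => v m ord0 k).

Definition measurable_state st : Prop :=
  forall i, measurable_rv (fun m => (st m).1 i) /\
            measurable_rv (fun m => (st m).2 i).

Lemma measurable_rv_cst u : measurable_rv (fun _ => u).
Proof. by move=> k; exact: measurable_cst. Qed.

Lemma measurable_rvD v w :
  measurable_rv v -> measurable_rv w -> measurable_rv (fun m => v m + w m).
Proof.
by move=> mv mw k; under eq_fun do rewrite mxE; exact: measurable_funD.
Qed.

Lemma measurable_rvZ c v : measurable_rv v -> measurable_rv (fun m => c *: v m).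
Proof.
move=> mv k; under eq_fun do rewrite mxE.
by apply: measurable_funM => //; exact: measurable_cst.
Qed.

Lemma measurable_rvB v w :
  measurable_rv v -> measurable_rv w -> measurable_rv (fun m => v m - w m).
Proof.
move=> mv mw; under eq_fun do rewrite -[- w _]scaleN1r.
exact/measurable_rvD/measurable_rvZ.
Qed.

Lemma measurable_rv_mean (v : 'I_n -> M -> 'rV[R]_d) :
  (forall i, measurable_rv (v i)) -> measurable_rv (fun m => mean (v ^~ m)).
Proof.
move=> mv; apply: measurable_rvZ => k; under eq_fun do rewrite summxE.
by apply: measurable_sum => i; exact: mv.
Qed.

Lemma measurable_rv_if (b : M -> bool) v w : measurable_fun setT b ->
  measurable_rv v -> measurable_rv w ->
  measurable_rv (fun m => if b m then v m else w m).
Proof.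
move=> mb mv mw k; rewrite (_ : (fun _ => _) = fun m =>
  if b m then v m ord0 k else w m ord0 k); first exact: measurable_fun_ifT.
by apply/funext => m; case: (b m).
Qed.

Lemma measurable_sqnorm v :
  measurable_rv v -> measurable_fun setT (fun m => sqnorm (v m)).
Proof. by move=> mv; apply: measurable_sum => k; exact: measurable_funM. Qed.

Lemma measurable_rv_sample (dS : measure_display) (S : measurableType dS)
    (g : 'rV[R]_d -> S -> 'rV[R]_d) v (s : M -> S) :
  jointly_measurable g -> measurable_rv v -> measurable_fun setT s ->
  measurable_rv (fun m => g (v m) (s m)).
Proof.
move=> mg mv ms k.
pose q m : d.-tuple R * S := ([tuple v m ord0 j | j < d], s m).
have mq : measurable_fun setT q.
  apply: measurable_fun_pair => //; apply/measurable_fun_tnthP => j.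
  rewrite (_ : _ \o _ = fun m => v m ord0 j)//.
  by apply/funext => m /=; rewrite tnth_mktuple.
have := measurableT_comp (mg k) mq; congr (measurable_fun _ _).
apply/funext => m /=; congr (g _ _ _ _).
by apply/rowP => j; rewrite mxE tnth_mktuple.
Qed.

Lemma measurable_fl_step gamma p (b : M -> bool)
    (gt : M -> 'I_n -> 'rV[R]_d) st :
  measurable_fun setT b -> (forall i, measurable_rv (gt ^~ i)) ->
  measurable_state st ->
  measurable_state (fun m => fl_step gamma p (b m) (gt m) (st m)).
Proof.
move=> mb mgt mst.
pose xhat i m := (st m).1 i - gamma *: (gt m i - (st m).2 i).
pose x' i m := xhat i m - (gamma / p) *: (st m).2 i.
pose xnew i m := if b m then mean (x' ^~ m) else xhat i m.
have mxhat i : measurable_rv (xhat i).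
  apply: measurable_rvB; first exact: (mst i).1.
  by apply/measurable_rvZ/measurable_rvB => //; exact: (mst i).2.
have mxnew i : measurable_rv (xnew i).
  apply: measurable_rv_if => //; apply: measurable_rv_mean => j.
  by apply: measurable_rvB => //; apply/measurable_rvZ; exact: (mst j).2.
rewrite (_ : (fun _ => _) = fun m => (xnew ^~ m,
    fun i => (st m).2 i + (p / gamma) *: (xnew i m - xhat i m))); last first.
  by apply/funext => m; rewrite /xnew /x' /xhat; case: (st m).
move=> i; split=> //=; apply: measurable_rvD; first exact: (mst i).2.
exact/measurable_rvZ/measurable_rvB.
Qed.

Lemma measurable_lyapunov gamma p (f : 'I_n -> 'rV[R]_d -> 'rV[R]_d) zs st :
  measurable_state st ->
  measurable_fun setT (fun m => lyapunov gamma p f zs (st m)).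
Proof.
move=> mst; apply: measurable_funD.
  apply: measurable_sum => i; apply/measurable_sqnorm/measurable_rvB.
    exact: (mst i).1.
  exact: measurable_rv_cst.
apply: measurable_funM; first exact: measurable_cst.
apply: measurable_sum => i; apply/measurable_sqnorm/measurable_rvB.
  exact: (mst i).2.
exact: measurable_rv_cst.
Qed.

End measurable_rv.

(** * Expectations *)

Section means.
Context (R : realType) (dS : measure_display) (S : measurableType dS).
Variable Q : probability S R.
Implicit Types (X Y : S -> R) (x y : R).

(** Integrability and the value of the expectation are kept together, so that
    linearity holds without side conditions. *)
Definition has_mean X x : Prop :=
  Q.-integrable setT (EFin \o X) /\ ('E_Q[X] = x%:E)%E.

Lemma has_mean_measurable X x : has_mean X x -> measurable_fun setT X.
Proof. by move=> [/measurable_int/measurable_EFinP]. Qed.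

Lemma has_mean_cst x : has_mean (fun _ => x) x.
Proof.
split; last exact: expectation_cst.
exact: finite_measure_integrable_cst.
Qed.

Lemma has_meanD X Y x y :
  has_mean X x -> has_mean Y y -> has_mean (fun s => X s + Y s) (x + y).
Proof.
move=> [iX eX] [iY eY]; split; first exact: (integrableD measurableT iX iY).
by move: eX eY; rewrite !unlock EFinD => <- <-; rewrite -integralD_EFin.
Qed.

Lemma has_meanZ c X x : has_mean X x -> has_mean (fun s => c * X s) (c * x).
Proof.
move=> [iX eX]; split; first exact: (integrableZl measurableT c iX).
by move: eX; rewrite !unlock EFinM => <-; rewrite -integralZl.
Qed.

Lemma has_meanB X Y x y :
  has_mean X x -> has_mean Y y -> has_mean (fun s => X s - Y s) (x - y).
Proof.
move=> hX /(has_meanZ (-1)) hY; have := has_meanD hX hY.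
by rewrite mulN1r; under eq_fun do rewrite mulN1r.
Qed.

Lemma has_mean_sum (I : Type) (r : seq I) (X : I -> S -> R) (x : I -> R) :
  (forall i, has_mean (X i) (x i)) ->
  has_mean (fun s => \sum_(i <- r) X i s) (\sum_(i <- r) x i).
Proof.
move=> hX; elim: r => [|i r IHr].
  by rewrite big_nil; under eq_fun do rewrite big_nil; exact: has_mean_cst.
rewrite big_cons; under eq_fun do rewrite big_cons.
exact: has_meanD.
Qed.

Lemma has_mean_le X Y x y :
  has_mean X x -> has_mean Y y -> (forall s, X s <= Y s) -> x <= y.
Proof.
move=> [iX eX] [iY eY] XY; rewrite -lee_fin -eX -eY !unlock.
by apply: le_integral => // s _; rewrite lee_fin.
Qed.

Lemma ge0_has_mean X : measurable_fun setT X -> (forall s, 0 <= X s) ->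
  ('E_Q[X] < +oo)%E -> has_mean X (fine 'E_Q[X]).
Proof.
move=> mX X0 fX; split; last first.
  by rewrite fineK// ge0_fin_numE// expectation_ge0.
apply/integrableP; split; first exact/measurable_EFinP.
move: fX; rewrite unlock; congr (_ < _)%E; apply: eq_integral => s _.
by rewrite /= ger0_norm.
Qed.

Lemma expectation_le_mean X Y y : measurable_fun setT X ->
  (forall s, 0 <= X s) -> (forall s, X s <= Y s) -> has_mean Y y ->
  ('E_Q[X] <= y%:E)%E.
Proof.
move=> mX X0 XY hY; have [iY <-] := hY; rewrite !unlock.
apply: ge0_le_integral => //.
- by move=> s _; rewrite lee_fin.
- exact/measurable_EFinP.
- exact: measurable_int iY.
- by move=> s _; rewrite lee_fin.
Qed.

Lemma ge0_expectationD X Y : measurable_fun setT X -> measurable_fun setT Y ->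
  (forall s, 0 <= X s) -> (forall s, 0 <= Y s) ->
  ('E_Q[fun s => (X s + Y s)%R] = 'E_Q[X] + 'E_Q[Y])%E.
Proof.
move=> /measurable_EFinP mX /measurable_EFinP mY X0 Y0; rewrite !unlock.
by rewrite -ge0_integralD// => s _; rewrite lee_fin.
Qed.

Lemma ge0_expectationZ c X : measurable_fun setT X -> 0 <= c ->
  (forall s, 0 <= X s) -> ('E_Q[fun s => (c * X s)%R] = c%:E * 'E_Q[X])%E.
Proof.
move=> /measurable_EFinP mX c0 X0; rewrite !unlock.
by rewrite -ge0_integralZl_EFin// => s _; rewrite lee_fin.
Qed.

Lemma ge0_expectation_sum (I : Type) (r : seq I) (X : I -> S -> R) :
  (forall i, measurable_fun setT (X i)) -> (forall i s, 0 <= X i s) ->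
  ('E_Q[fun s => (\sum_(i <- r) X i s)%R] = \sum_(i <- r) 'E_Q[X i])%E.
Proof.
move=> mX X0; rewrite expectation.unlock.
under eq_integral do rewrite /= -sumEFin.
rewrite ge0_integral_sum// => [i|i s _]; first exact/measurable_EFinP/mX.
by rewrite lee_fin.
Qed.

End means.

(** * One stochastic gradient step at a fixed point *)

Section one_client.
Context (R : realType) (d : nat) (dS : measure_display) (S : measurableType dS).
Variables (Q : probability S R) (g : 'rV[R]_d -> S -> 'rV[R]_d).
Variables (F : 'rV[R]_d -> 'rV[R]_d) (zs : 'rV[R]_d) (L : R).
Hypothesis g_unbiased : unbiased Q g F.
Hypothesis g_cocoercive : expected_cocoercive Q L g F zs.

Let has_mean_g u k : has_mean Q (fun s => g u s ord0 k) (F u ord0 k).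
Proof. exact: g_unbiased. Qed.

Lemma has_mean_dotv (a : 'rV[R]_d) (v : S -> 'rV[R]_d) (m : 'rV[R]_d) :
  (forall k, has_mean Q (fun s => v s ord0 k) (m ord0 k)) ->
  has_mean Q (fun s => dotv a (v s)) (dotv a m).
Proof. by move=> hv; apply: has_mean_sum => k; exact: has_meanZ. Qed.

Let G u s := g u s - g zs s.

Let has_mean_G u k :
  has_mean Q (fun s => G u s ord0 k) ((F u - F zs) ord0 k).
Proof.
by rewrite !mxE; under eq_fun do rewrite !mxE; exact: has_meanB.
Qed.

Lemma has_mean_sqnorm_diff u :
  exists2 m, has_mean Q (fun s => sqnorm (G u s)) m
           & m <= L * dotv (F u - F zs) (u - zs).
Proof.
have fin : ('E_Q[fun s => sqnorm (G u s)] < +oo)%E.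
  exact: le_lt_trans (g_cocoercive u) (ltry _).
have hm := ge0_has_mean
  (measurable_sqnorm (fun k => has_mean_measurable (has_mean_G u k)))
  (fun s => sqnorm_ge0 _) fin.
exists (fine ('E_Q[fun s => sqnorm (G u s)])%E) => //.
by rewrite -lee_fin -hm.2 g_cocoercive.
Qed.

(** Jensen's inequality for the squared norm, obtained by integrating
    [0 <= sqnorm (D - G u s)], where [D = F u - F zs] is the mean of [G u]. *)
Lemma cocoercive u :
  sqnorm (F u - F zs) <= L * dotv (F u - F zs) (u - zs).
Proof.
have [m hm mL] := has_mean_sqnorm_diff u; apply: le_trans mL.
set D := F u - F zs.
have hD : has_mean Q (fun s => 2 * dotv D (G u s) - sqnorm D)
                     (2 * dotv D D - sqnorm D).
  apply: has_meanB; last exact: has_mean_cst.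
  by apply/has_meanZ/has_mean_dotv => k; exact: has_mean_G.
have -> : sqnorm D = 2 * dotv D D - sqnorm D by rewrite -/(sqnorm D); lra.
apply: has_mean_le hD hm _ => s.
have := sqnorm_ge0 (D - G u s); rewrite sqnormB; lra.
Qed.

(** Cocoercivity and [0 <= sqnorm (D - L *: a)] bound [dotv D a] by
    [L * sqnorm a], while monotonicity bounds it below by [mu * sqnorm a]; a
    nonzero displacement [a] exists as soon as [0 < d]. *)
Lemma monotone_le_cocoercive mu : (0 < d)%N -> 0 < L ->
  quasi_strongly_monotone mu F zs -> mu <= L.
Proof.
move=> d0 L0 qsm.
pose a : 'rV[R]_d := const_mx 1.
have a_gt0 : 0 < sqnorm a.
  rewrite /sqnorm /dotv (eq_bigr (fun=> 1)).
    by rewrite sumr_const card_ord ltr0n.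
  by move=> k _; rewrite !mxE mul1r.
have := qsm (zs + a); have := cocoercive (zs + a).
rewrite addrAC subrr add0r; set D := F _ - F zs => coc mon.
rewrite -(ler_pM2r a_gt0); apply: le_trans mon _.
have := sqnorm_ge0 (D - L *: a); rewrite sqnormB sqnormZ dotvZr => sq.
by rewrite -(ler_pM2l L0); lra.
Qed.

Variables (mu gamma : R).
Hypotheses (mu_ge0 : 0 <= mu) (gamma_ge0 : 0 <= gamma).
Hypothesis F_monotone : quasi_strongly_monotone mu F zs.
Hypothesis gammaL : gamma * L <= 1 / 2.
Hypothesis noise_fin : ('E_Q[fun s => sqnorm (g zs s - F zs)] < +oo)%E.

(** The second moment of [g u s - F zs] splits into the cocoercive part
    [g u s - g zs s] and the noise at [zs], at the cost of a factor 2. As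
    [gamma * L <= 1 / 2], the cocoercive part absorbs only half of the descent
    term [2 * gamma * dotv (F u - F zs) (u - zs)], and strong monotonicity turns
    the other half into the contraction. *)
Lemma expected_gradient_step u :
  ('E_Q[fun s => sqnorm (u - zs - gamma *: (g u s - F zs))]
   <= ((1 - gamma * mu) * sqnorm (u - zs)
       + 2 * gamma ^+ 2 * fine 'E_Q[fun s => sqnorm (g zs s - F zs)])%:E)%E.
Proof.
set s2 := fine _; set a := u - zs.
have mB v k : has_mean Q (fun s => (g v s - F zs) ord0 k) ((F v - F zs) ord0 k).
  rewrite !mxE; under eq_fun do rewrite !mxE.
  by apply: has_meanB; [exact: has_mean_g | exact: has_mean_cst].
have hN : has_mean Q (fun s => sqnorm (g zs s - F zs)) s2.
  apply: ge0_has_mean noise_fin => [|s]; last exact: sqnorm_ge0.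
  by apply: measurable_sqnorm => k; exact: has_mean_measurable (mB zs k).
have [m hm mL] := has_mean_sqnorm_diff u.
pose Y s := sqnorm a - 2 * gamma * dotv a (g u s - F zs)
            + 2 * gamma ^+ 2 * (sqnorm (G u s) + sqnorm (g zs s - F zs)).
have hY : has_mean Q Y (sqnorm a - 2 * gamma * dotv a (F u - F zs)
                        + 2 * gamma ^+ 2 * (m + s2)).
  apply: has_meanD; last by apply/has_meanZ/has_meanD.
  apply: has_meanB; first exact: has_mean_cst.
  by apply/has_meanZ/has_mean_dotv => k; exact: mB.
apply: (@le_trans _ _ (sqnorm a - 2 * gamma * dotv a (F u - F zs)
                        + 2 * gamma ^+ 2 * (m + s2))%:E).
  apply: expectation_le_mean hY => [|s|s]; last 2 first.
  - exact: sqnorm_ge0.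
  - rewrite sqnormB dotvZr sqnormZ /Y.
    rewrite (_ : g u s - F zs = G u s + (g zs s - F zs)).
      have := ler_wpM2l (sqr_ge0 gamma) (sqnormD_le (G u s) (g zs s - F zs)).
      lra.
    by rewrite addrA subrK.
  apply/measurable_sqnorm/measurable_rvB; first exact: measurable_rv_cst.
  by apply/measurable_rvZ => k; exact: has_mean_measurable (mB u k).
rewrite lee_fin; have := F_monotone u; rewrite -/a [dotv a _]dotvC.
rewrite -/a in mL; move: (dotv _ a) mL => q mL mq.
have q_ge0 : 0 <= q by apply: le_trans mq; rewrite mulr_ge0 ?sqnorm_ge0.
have m_le : gamma ^+ 2 * m <= gamma * q / 2.
  have := ler_wpM2l (sqr_ge0 gamma) mL.
  have := ler_wpM2r (mulr_ge0 gamma_ge0 q_ge0) gammaL; lra.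
have := ler_wpM2l gamma_ge0 mq; lra.
Qed.

End one_client.

Lemma integral_coin (R : realType) (Q : probability bool R) (p : R)
    (f : bool -> \bar R) :
  Q [set true] = p%:E -> (forall b, (0 <= f b)%E) ->
  (\int[Q]_b f b = p%:E * f true + (1 - p)%:E * f false)%E.
Proof.
move=> Qp f0.
have p01 : 0 <= p <= 1 by rewrite -!lee_fin -Qp measure_ge0 probability_le1.
rewrite -integral_bernoulli_prob//; apply: eq_measure_integral => A _ _.
exact: eq_bernoulli.
Qed.

(** * The expected Lyapunov recursion *)

Section run.
Context (R : realType) (n d : nat).
Context (dS : 'I_n -> measure_display) (S : forall i, measurableType (dS i)).
Context (dO : measure_display) (Omega : measurableType dO).
Variables (g : forall i, 'rV[R]_d -> S i -> 'rV[R]_d).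
Arguments g : clear implicits.
Variables (xi : forall i, nat -> {mfun Omega >-> S i}).
Variables (theta : nat -> {mfun Omega >-> bool}).
Variables (gamma p : R) (st0 : fl_state R n d).
Hypothesis g_measurable : forall i, jointly_measurable (g i).

Local Notation run := (fl_run g xi theta gamma p st0).
Local Notation past := (past_events xi theta).
Local Notation pre_coin t :=
  (past t `|` estimate_events g xi theta gamma p st0 t).

(** The map [e] makes this usable both on [Omega] itself and on its coarsenings,
    which need only contain the randomness drawn before [t]. *)
Lemma measurable_run (dM : measure_display) (M : measurableType dM)
    (e : M -> Omega) t :
  (forall s, (s < t)%N -> (forall i, measurable_fun setT (xi i s \o e)) /\
                          measurable_fun setT (theta s \o e)) ->
  measurable_state (fun m => run t (e m)).
Proof.
elim: t => [|t IHt] mst /=.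
  by move=> i; split; exact: measurable_rv_cst.
have {}IHt := IHt (fun s st => mst s (ltnW st)).
have [mxi mtheta] := mst t (ltnSn t).
apply: measurable_fl_step => // i.
by apply: measurable_rv_sample => //; exact: (IHt i).1.
Qed.

Lemma past_events_measurable t : past t `<=` measurable.
Proof.
by move=> A [s _] [[i _]|] [B mB <-]; rewrite setTI -[_ @^-1` _]setTI;
   exact: measurable_funP.
Qed.

Lemma measurable_run_Omega t : measurable_state (run t).
Proof.
apply: (@measurable_run _ _ idfun) => s _.
by split=> [i|]; exact: measurable_funP.
Qed.

Lemma pre_coin_measurable t : pre_coin t `<=` measurable.
Proof.
move=> A [/past_events_measurable//|] [i _] [k _] [B mB <-].
suff /(_ k) : measurable_rv (fl_estimate g xi theta gamma p st0 t i) by apply.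
apply: measurable_rv_sample => //; exact: (measurable_run_Omega t i).1.
Qed.

Lemma measurable_run_past t (G : set_system Omega) : past t `<=` G ->
  measurable_state (fun m : coarsening G => run t m).
Proof.
move=> pastG; apply: (@measurable_run _ _ (idfun : coarsening G -> Omega)).
move=> s st; split=> [i|] _ B mB; apply: sub_sigma_algebra; apply: pastG;
  exists s => //; [left; exists i => // | right]; by exists B.
Qed.

Lemma measurable_estimate t i :
  measurable_rv (fun m : coarsening (pre_coin t) =>
                   fl_estimate g xi theta gamma p st0 t i m).
Proof.
move=> k _ B mB; apply: sub_sigma_algebra; right.
by exists i => //; exists k => //; exists B.
Qed.

Variable P : probability Omega R.
Variables (Q : forall i, probability (S i) R).
Variables (f : 'I_n -> 'rV[R]_d -> 'rV[R]_d) (zs : 'rV[R]_d) (mu L : R).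
Hypotheses (n_gt0 : (0 < n)%N) (mu_gt0 : 0 < mu) (gamma_gt0 : 0 < gamma).
Hypotheses (p_gt0 : 0 < p) (p_le1 : p <= 1) (p_sqr : p ^+ 2 = gamma * mu).
Hypothesis gammaL : gamma * L <= 1 / 2.
Hypothesis mean_f0 : mean (fun i => f i zs) = 0.
Hypothesis f_monotone : forall i, quasi_strongly_monotone mu (f i) zs.
Hypothesis g_unbiased : forall i, unbiased (Q i) (g i) (f i).
Hypothesis g_cocoercive : forall i, expected_cocoercive (Q i) L (g i) (f i) zs.
Hypothesis noise_fin : (noise_at Q g f zs < +oo)%E.
Hypothesis xi_fresh : fresh_samples xi theta P Q.
Hypothesis theta_indep : independent_coins g xi theta P gamma p st0.

Local Notation est := (fl_estimate g xi theta gamma p st0).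
Let V t w := lyapunov gamma p f zs (run t w).
Let control t w := \sum_(i < n) sqnorm ((run t w).2 i - f i zs).
Let noise i : R := fine 'E_(Q i)[fun s => sqnorm (g i zs s - f i zs)].

Lemma lyapunov_ge0 st : 0 <= lyapunov gamma p f zs st.
Proof.
apply: addr_ge0; first exact: sum_sqnorm_ge0.
by apply: mulr_ge0; [exact: sqr_ge0 | exact: sum_sqnorm_ge0].
Qed.

Lemma noise_at_fin i : ('E_(Q i)[fun s => sqnorm (g i zs s - f i zs)] < +oo)%E.
Proof.
apply: le_lt_trans noise_fin; rewrite /noise_at (bigD1 i)//= leeDl//.
by apply: sume_ge0 => j _; apply: expectation_ge0 => s; exact: sqnorm_ge0.
Qed.

Lemma sum_noise : \sum_(i < n) noise i = fine (noise_at Q g f zs).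
Proof.
apply: sum_fine => i _; rewrite ge0_fin_numE ?noise_at_fin//.
by apply: expectation_ge0 => s; exact: sqnorm_ge0.
Qed.

Lemma fine_noise_at_ge0 : 0 <= fine (noise_at Q g f zs).
Proof.
rewrite fine_ge0//; apply: sume_ge0 => i _; apply: expectation_ge0 => s.
exact: sqnorm_ge0.
Qed.

(** The coin is integrated out given the past and the current estimates. *)
Lemma expected_coin_step t :
  ('E_P[V t.+1] = 'E_P[fun w => (\sum_(i < n)
      sqnorm ((run t w).1 i - zs - gamma *: (est t i w - f i zs))
    + (1 - p ^+ 2) * ((gamma / p) ^+ 2 * control t w))%R])%E.
Proof.
pose phi (z : coarsening (pre_coin t) * bool) : \bar R :=
  (lyapunov gamma p f zs
     (fl_step gamma p z.2 (est t ^~ z.1) (run t z.1)))%:E.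
have mphi : measurable_fun setT phi.
  apply/measurable_EFinP; apply: measurable_lyapunov; apply: measurable_fl_step.
  - exact: measurable_snd.
  - move=> i k.
    exact: (measurableT_comp (measurable_estimate i k) measurable_fst).
  - have mr := measurable_run_past (@subsetUl _ (past t)
      (estimate_events g xi theta gamma p st0 t)).
    by move=> i; split=> k; [have m := (mr i).1 k | have m := (mr i).2 k];
       exact: (measurableT_comp m measurable_fst).
have phi0 z : (0 <= phi z)%E by rewrite lee_fin lyapunov_ge0.
have [Ptheta indep] := theta_indep.
rewrite !expectation.unlock.
transitivity (\int[P]_w phi (w, theta t w))%E; first by [].
rewrite (@integral_freezing _ _ _ (@pre_coin_measurable t)) => //; last first.
  by move=> a b Ga Gb; apply: (indep t) => // B [_]; exact.
apply: eq_integral => w _; rewrite (@integral_coin _ _ p)//; last first.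
  by rewrite -(Ptheta t); congr (P _); apply/seteqP; split.
rewrite /phi /= -!EFinM -EFinD; congr EFin.
case E : (run t w) => [x h] /=.
by rewrite lyapunov_coin_average ?gt_eqF// /control E.
Qed.

(** The sample is integrated out given the past, which determines the current
    state; [expected_gradient_step] then applies at each frozen iterate. *)
Lemma expected_sample_step t i :
  ('E_P[fun w => sqnorm ((run t w).1 i - zs - gamma *: (est t i w - f i zs))]
   <= 'E_P[fun w => ((1 - gamma * mu) * sqnorm ((run t w).1 i - zs)
                     + 2 * gamma ^+ 2 * noise i)%R])%E.
Proof.
pose phi (z : coarsening (past t) * S i) : \bar R :=
  (sqnorm ((run t z.1).1 i - zs
           - gamma *: (g i ((run t z.1).1 i) z.2 - f i zs)))%:E.
have mx : measurable_rv (fun z : coarsening (past t) * S i => (run t z.1).1 i).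
  move=> k; have m := (measurable_run_past (@subset_refl _ (past t)) i).1 k.
  exact: (measurableT_comp m measurable_fst).
have mphi : measurable_fun setT phi.
  apply/measurable_EFinP/measurable_sqnorm/measurable_rvB.
    by apply: measurable_rvB => //; exact: measurable_rv_cst.
  apply/measurable_rvZ/measurable_rvB; last exact: measurable_rv_cst.
  by apply: measurable_rv_sample => //; exact: measurable_snd.
have phi0 z : (0 <= phi z)%E by rewrite lee_fin sqnorm_ge0.
have [law indep] := xi_fresh.
rewrite !expectation.unlock.
apply: (@integral_freezing_le _ _ _ (@past_events_measurable t) _ _ _ _
          (xi i t) phi) => //.
- by move=> a b Ga Gb; apply: (indep t) => // B [_]; apply; exists i.
- apply/measurable_EFinP; apply: measurable_funD; last exact: measurable_cst.
  apply: measurable_funM; first exact: measurable_cst.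
  apply/measurable_sqnorm/measurable_rvB; last exact: measurable_rv_cst.
  exact: (measurable_run_Omega t i).1.
- move=> w; rewrite (eq_measure_integral (Q i)); last first.
    by move=> B mB _; exact: law.
  have := expected_gradient_step (g_unbiased i) (g_cocoercive i) (ltW mu_gt0)
    (ltW gamma_gt0) (f_monotone i) gammaL (noise_at_fin i) ((run t w).1 i).
  by rewrite -/(noise i) expectation.unlock.
Qed.

Lemma expected_lyapunov_step t :
  ('E_P[V t.+1] <= (1 - gamma * mu)%:E * 'E_P[V t]
     + (2 * gamma ^+ 2 * fine (noise_at Q g f zs))%:E)%E.
Proof.
have mrun := measurable_run_Omega t.
have mx i : measurable_rv (fun w => (run t w).1 i - zs).
  by apply: measurable_rvB; [exact: (mrun i).1 | exact: measurable_rv_cst].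
have mcontrol : measurable_fun setT
    (fun w => (1 - p ^+ 2) * ((gamma / p) ^+ 2 * control t w)).
  do 2 (apply: measurable_funM; first exact: measurable_cst).
  apply: measurable_sum => i; apply/measurable_sqnorm/measurable_rvB.
    exact: (mrun i).2.
  exact: measurable_rv_cst.
have p2_le1 : 0 <= 1 - p ^+ 2 by rewrite subr_ge0 expr_le1// ltW.
have q_ge0 : 0 <= 1 - gamma * mu by rewrite -p_sqr.
have control_ge0 w : 0 <= (1 - p ^+ 2) * ((gamma / p) ^+ 2 * control t w).
  apply: mulr_ge0 => //; apply: mulr_ge0; first exact: sqr_ge0.
  exact: sum_sqnorm_ge0.
have noise_ge0 i : 0 <= noise i.
  by rewrite fine_ge0// expectation_ge0// => s; exact: sqnorm_ge0.
have mstep i : measurable_fun setT (fun w =>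
    sqnorm ((run t w).1 i - zs - gamma *: (est t i w - f i zs))).
  apply/measurable_sqnorm/measurable_rvB => //.
  apply/measurable_rvZ/measurable_rvB.
    by apply: measurable_rv_sample => //; exact: (mrun i).1.
  exact: measurable_rv_cst.
pose C i w := (1 - gamma * mu) * sqnorm ((run t w).1 i - zs)
              + 2 * gamma ^+ 2 * noise i.
have mC i : measurable_fun setT (C i).
  apply: measurable_funD; last exact: measurable_cst.
  by apply: measurable_funM; [exact: measurable_cst | exact: measurable_sqnorm].
have C_ge0 i w : 0 <= C i w.
  apply: addr_ge0; first by apply: mulr_ge0 => //; exact: sqnorm_ge0.
  by apply: mulr_ge0 => //; apply: mulr_ge0 => //; exact: sqr_ge0.
rewrite expected_coin_step ge0_expectationD//; last 2 first.
- exact: measurable_sum.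
- by move=> w; exact: sum_sqnorm_ge0.
rewrite ge0_expectation_sum//; last by move=> i w; exact: sqnorm_ge0.
apply: (@le_trans _ _ (\sum_(i < n) 'E_P[C i]
    + 'E_P[fun w => ((1 - p ^+ 2) * ((gamma / p) ^+ 2 * control t w))%R])%E).
  by apply: leeD => //; apply: lee_sum => i _; exact: expected_sample_step.
rewrite -ge0_expectation_sum// -ge0_expectationD//; last 2 first.
- exact: measurable_sum.
- by move=> w; apply: sumr_ge0 => i _; exact: C_ge0.
rewrite -ge0_expectationZ//; last 2 first.
- exact: measurable_lyapunov.
- by move=> w; exact: lyapunov_ge0.
rewrite -[X in (_ <= _ + X)%E](expectation_cst P).
rewrite -ge0_expectationD//; last 3 first.
- by apply: measurable_funM; [exact: measurable_cst | exact: measurable_lyapunov].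
- by move=> w; apply: mulr_ge0 => //; exact: lyapunov_ge0.
- move=> w; apply: mulr_ge0; last exact: fine_noise_at_ge0.
  by apply: mulr_ge0 => //; exact: sqr_ge0.
rewrite le_eqVlt; apply/orP; left; apply/eqP; congr ('E_P[_])%E.
apply/funext => w; rewrite /C /V /lyapunov -/(control t w) big_split /=.
by rewrite -!mulr_sumr sum_noise p_sqr; ring.
Qed.

(** The additive constant [2 * gamma * sigma2 / mu] is the fixed point of the
    affine recursion of [expected_lyapunov_step]. *)
Lemma expected_lyapunov t :
  ('E_P[V t] <= ((1 - gamma * mu) ^+ t * lyapunov gamma p f zs st0
     + 2 * gamma * fine (noise_at Q g f zs) / mu)%:E)%E.
Proof.
set s2 := fine _; set V0 := lyapunov _ _ _ _ st0.
have s2_ge0 : 0 <= s2 := fine_noise_at_ge0.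
elim: t => [|t IHt].
  rewrite expr0 mul1r (_ : V 0%N = cst V0)// expectation_cst lee_fin lerDl.
  by rewrite !mulr_ge0 ?invr_ge0// ltW.
apply: (le_trans (expected_lyapunov_step t)).
have q_ge0 : 0 <= 1 - gamma * mu by rewrite -p_sqr subr_ge0 expr_le1// ltW.
apply: (@le_trans _ _ ((1 - gamma * mu)%:E * ((1 - gamma * mu) ^+ t * V0
     + 2 * gamma * s2 / mu)%:E + (2 * gamma ^+ 2 * s2)%:E)%E).
  by rewrite leeD2r// lee_wpmul2l.
rewrite -EFinM -EFinD lee_fin [_ ^+ t.+1]exprS; move: (_ ^+ t) => y.
by rewrite le_eqVlt; apply/orP; left; apply/eqP; field; rewrite gt_eqF.
Qed.

End run.

(** * Complexity *)

Lemma expected_comm_rounds (R : realType) (dO : measure_display)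
    (Omega : measurableType dO) (P : probability Omega R)
    (theta : nat -> {mfun Omega >-> bool}) (p : R) (T : nat) :
  (forall t, P [set w | theta t w] = p%:E) ->
  ('E_P[comm_rounds R theta T] = (p * T%:R)%:E)%E.
Proof.
move=> Ptheta.
have coin t : has_mean P (fun w => (theta t w : nat)%:R) p.
  pose A := [set w | theta t w].
  have mA : measurable A.
    rewrite -[A]setTI.
    exact: (measurable_funP (theta t) measurableT [set true]).
  rewrite (_ : (fun _ => _) = \1_A); last first.
    by apply/funext => w; rewrite indicE; congr (nat_of_bool _)%:R;
       apply/idP/idP; rewrite inE.
  by split; [exact: integrable_indic | rewrite expectation_indic// -(Ptheta t)].
have := has_mean_sum (index_enum 'I_T) (fun t : 'I_T => coin t).
by move=> [_ ->]; rewrite sumr_const card_ord mulr_natr.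
Qed.

Section stepsize.
Context (R : realType).
Variables (L mu sigma2 eps : R).
Hypotheses (L_gt0 : 0 < L) (mu_gt0 : 0 < mu) (sigma2_ge0 : 0 <= sigma2).
Hypotheses (eps_gt0 : 0 < eps) (mu_le_L : mu <= L).

Local Notation gamma := (stepsize L mu sigma2 eps).
Let N := Num.max (L / mu) (sigma2 / (mu ^+ 2 * eps)).

(** In the last bound, each regime of the step size is matched with a term of
    the maximum [N]. There are two of them: [mu <= L] makes [1 / (2 * L)] the
    smaller of the first two candidates. *)
Lemma stepsizeP :
  [/\ 0 < gamma, gamma * L <= 1 / 2, gamma * mu <= 1 / 2,
      2 * gamma * sigma2 / mu <= eps / 4 & 1 <= 8 * N * (gamma * mu)].
Proof.
have L2 : 1 / (2 * L) * L = 1 / 2 by field; rewrite gt_eqF.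
have mu2 : 1 / (2 * mu) * mu = 1 / 2 by field; rewrite gt_eqF.
have inv_gt0 x : 0 < x -> 0 < 1 / (2 * x).
  by move=> x0; rewrite divr_gt0 ?mulr_gt0.
have minLE : Num.min (1 / (2 * L)) (1 / (2 * mu)) = 1 / (2 * L).
  by apply/min_idPl; rewrite !div1r lef_pV2 ?posrE ?mulr_gt0// ler_pM2l.
have NL : L / mu <= N by rewrite le_max lexx.
have Nmu : L <= N * mu by rewrite -ler_pdivrMr.
have N_gt0 : 0 < N by apply: lt_le_trans NL; rewrite divr_gt0.
have complexityL : 1 <= 8 * N * (1 / (2 * L) * mu).
  rewrite (_ : 8 * N * _ = 4 * (N * mu / L)); last by field; rewrite gt_eqF.
  have : 1 <= N * mu / L by rewrite ler_pdivlMr// mul1r.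
  lra.
rewrite /stepsize minLE; case: eqP => [->|/eqP s_neq0].
  split; rewrite ?inv_gt0 ?L2//.
    by rewrite -L2 ler_wpM2l// ltW// inv_gt0.
  by rewrite mulr0 mul0r divr_ge0// ltW.
have s_gt0 : 0 < sigma2 by rewrite lt_neqAle eq_sym s_neq0.
have b_gt0 : 0 < mu * eps / (8 * sigma2) by rewrite divr_gt0 ?mulr_gt0.
set b := mu * eps / (8 * sigma2) in b_gt0 *.
set m := Num.min _ _.
have m_gt0 : 0 < m by rewrite lt_min inv_gt0.
have mL : m * L <= 1 / 2 by rewrite -L2 ler_pM2r// ge_min lexx.
split => //.
- by apply: le_trans mL; rewrite ler_pM2l.
- have mb : m <= b by rewrite ge_min lexx orbT.
  have -> : eps / 4 = 2 * b * sigma2 / mu by rewrite /b; field; rewrite !gt_eqF.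
  by rewrite ler_pM2r ?invr_gt0// ler_pM2r// ler_pM2l.
- rewrite /m minElt; case: ifP => _ //.
  have Ns : sigma2 / (mu ^+ 2 * eps) <= N by rewrite le_max lexx orbT.
  have -> : 8 * N * (b * mu) = N / (sigma2 / (mu ^+ 2 * eps)).
    by rewrite /b; field; rewrite !gt_eqF.
  by rewrite ler_pdivlMr ?mul1r// divr_gt0// mulr_gt0// exprn_gt0.
Qed.

End stepsize.

(** [T] is the first integer above [(ln v + ln 2) / r], since
    [(1 - r) ^+ T <= expR (- r * T%:R)]. The assumption [2 <= v] makes
    [ln v >= 1 / 2], so that both [ln 2] and the rounding are absorbed into a
    multiple of [ln v]. *)
Lemma iteration_count (R : realType) (r N v : R) :
  0 < r -> r <= 1 / 2 -> 1 <= 8 * N * r -> 2 <= v ->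
  exists T : nat, [/\ (1 - r) ^+ T <= 1 / (2 * v),
    T%:R <= 32 * N * ln v & Num.sqrt r * T%:R <= 32 * Num.sqrt N * ln v].
Proof.
move=> r0 r2 Nr v2.
have v0 : 0 < v by lra.
have l2 : 1 / 2 <= ln 2 :> R.
  (* [ln (1 + x) <= x] at [x = - 1 / 2] *)
  have : ln (1 + - (1 / 2)) <= - (1 / 2) :> R by apply: le_ln1Dx; lra.
  by rewrite (_ : 1 + - (1 / 2) = 2^-1) ?lnV ?posrE//; lra.
have lv : ln 2 <= ln v by rewrite ler_ln ?posrE.
set l := ln v in lv *.
have lr : 0 <= l / r by rewrite divr_ge0 ?ltW//; lra.
have N0 : 0 <= N by rewrite -(pmulr_lge0 _ r0); lra.
set y := (l + ln 2) / r.
have y0 : 0 <= y by rewrite divr_ge0 ?ltW//; lra.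
exists (Num.trunc y).+1.
set T := (Num.trunc y).+1.
have yT : y < T%:R := truncnS_gt y.
have Ty : T%:R <= 4 * (l / r).
  have : T%:R <= y + 1 by rewrite -natr1 lerD2r truncn_le.
  have : y <= 2 * (l / r).
    by rewrite /y mulrA ler_pM2r ?invr_gt0//; lra.
  have : 1 <= 2 * (l / r); last by lra.
  by rewrite mulrA ler_pdivlMr//; lra.
have lrN : l / r <= 8 * N * l by rewrite ler_pdivrMr//; nra.
split.
- apply: (@le_trans _ _ (expR (- r * T%:R))).
    rewrite expRM_natr lerXn2r ?nnegrE ?expR_ge0//; first by lra.
    exact: expR_ge1Dx.
  have -> : 1 / (2 * v) = expR (- (l + ln 2)).
    by rewrite expRN expRD !lnK ?posrE// div1r mulrC.
  by rewrite ler_expR mulNr lerN2 mulrC -ler_pdivrMr// ltW.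
- lra.
- (* [8 * N * r >= 1] gives [3 * sqrt N * sqrt r >= 1] since [8 <= 9]. *)
  set q := Num.sqrt r; set s := Num.sqrt N.
  have q0 : 0 < q by rewrite sqrtr_gt0.
  have s0 : 0 <= s := sqrtr_ge0 _.
  have qq : q ^+ 2 = r by rewrite sqr_sqrtr// ltW.
  have ss : s ^+ 2 = N by rewrite sqr_sqrtr.
  have sq1 : 1 <= 3 * s * q.
    rewrite -(@ler_pXn2r _ 2)// ?nnegrE//; last by rewrite !mulr_ge0// ltW.
    by rewrite expr1n !exprMn qq ss; lra.
  apply: (@le_trans _ _ (q * (4 * (l / r)))); first by rewrite ler_pM2l.
  have -> : q * (4 * (l / r)) = 4 * l / q.
    by rewrite -qq; field; rewrite gt_eqF.
  by rewrite ler_pdivrMr//; nra.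
Qed.

Theorem theorem4p2 (R : realType) :
  exists2 c : R, 0 < c &
  forall (n d : nat) (f : 'I_n -> 'rV[R]_d -> 'rV[R]_d) (zs : 'rV[R]_d)
    (mu Lg eps : R)
    (dS : 'I_n -> measure_display) (S : forall i, measurableType (dS i))
    (Q : forall i, probability (S i) R)
    (g : forall i, 'rV[R]_d -> S i -> 'rV[R]_d)
    (dO : measure_display) (Omega : measurableType dO)
    (P : probability Omega R)
    (xi : forall i, nat -> {mfun Omega >-> S i})
    (theta : nat -> {mfun Omega >-> bool})
    (x0 h0 : 'I_n -> 'rV[R]_d),
  (0 < n)%N ->
  unique (vip_solution (fun z => mean (fun i => f i z))) zs ->
  0 < mu ->
  (forall i, quasi_strongly_monotone mu (f i) zs) ->
  (forall i, jointly_measurable (g i)) ->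
  (forall i, unbiased (Q i) (g i) (f i)) ->
  0 < Lg ->
  (forall i, expected_cocoercive (Q i) Lg (g i) (f i) zs) ->
  (noise_at Q g f zs < +oo)%E ->
  0 < eps ->
  let sigma2 := fine (noise_at Q g f zs) in
  let gamma := stepsize Lg mu sigma2 eps in
  let p := Num.sqrt (gamma * mu) in
  let V t w := lyapunov gamma p f zs (fl_run g xi theta gamma p (x0, h0) t w) in
  let V0 := lyapunov gamma p f zs (x0, h0) in
  let N := Num.max (Lg / mu) (sigma2 / (mu ^+ 2 * eps)) in
  fresh_samples xi theta P Q ->
  independent_coins g xi theta P gamma p (x0, h0) ->
  eps <= V0 / 2 ->
  exists T : nat,
    [/\ ('E_P[V T] <= eps%:E)%E,
        T%:R <= c * N * ln (V0 / eps),
        ('E_P[comm_rounds R theta T] = (p * T%:R)%:E)%E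
      & p * T%:R <= c * Num.sqrt N * ln (V0 / eps)].
Proof.
exists 32 => //.
move=> n d f zs mu L eps dS S Q g dO Omega P xi theta x0 h0 n0 [zsP _] mu0 qsm jm.
move=> ub L0 coco fin eps0 sigma2 gamma p V V0 N fresh coins epsV.
have mf0 := vip_solution_mean0 zsP.
have V0_ge : 2 * eps <= V0 by lra.
have d_gt0 : (0 < d)%N.
  case: (posnP d) => // d0; suff V00 : V0 = 0 by move: V0_ge; rewrite V00; lra.
  have sq0 (u : 'rV[R]_d) : sqnorm u = 0.
    by apply: big1 => k _; have := ltn_ord k; rewrite [X in (_ < X)%N]d0.
  by rewrite /V0 /lyapunov !big1 ?mulr0 ?addr0.
have muL : mu <= L.
  exact: (monotone_le_cocoercive (ub (Ordinal n0)) (coco _) d_gt0 L0 (qsm _)).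
have s2_ge0 : 0 <= sigma2 by exact: fine_noise_at_ge0.
have [gamma0 gammaL gammamu noise_le Nr] := stepsizeP L0 mu0 s2_ge0 eps0 muL.
rewrite -/gamma -/N in gamma0 gammaL gammamu noise_le Nr.
have r0 : 0 < gamma * mu by rewrite mulr_gt0.
have p0 : 0 < p by rewrite sqrtr_gt0.
have pp : p ^+ 2 = gamma * mu by rewrite sqr_sqrtr// ltW.
have p1 : p <= 1 by rewrite -(@ler_pXn2r _ 2)// ?nnegrE ?ltW// pp expr1n; lra.
have v2 : 2 <= V0 / eps by rewrite ler_pdivlMr.
have [T [decay T_le pT_le]] := iteration_count r0 gammamu Nr v2.
exists T; split => //; last exact: expected_comm_rounds coins.1.
apply: (le_trans (expected_lyapunov jm n0 mu0 gamma0 p0 p1 pp gammaL mf0 qsm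
  ub coco fin fresh coins T)).
rewrite lee_fin -/V0 -/sigma2.
have V0_gt0 : 0 < V0 by lra.
have := ler_wpM2r (ltW V0_gt0) decay.
have -> : 1 / (2 * (V0 / eps)) * V0 = eps / 2 by field; rewrite !gt_eqF.
lra.
Qed.
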